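(* Let $0<u_0<u_1$ with $[u_0,u_1]\subset I$, let $v_0<v_1$, and let $A=(u_0,v_0)$, $B=(u_1,v_1)$ be two points in geodesic coordinates. Suppose that the angular amplitude $\Delta v=v_1-v_0$ satisfies $$\Delta v> \Phi(u_1)-\Phi(u_0).$$ Then the minimum value of the resistance functional $\mathcal{R}$ in the class $\mathcal{C}^m_{0,1}$ is $$\Delta v-\tfrac12\big(\Phi(u_1)-\Phi(u_0)\big),$$ and this minimum value is attained by the truncated loxodrome $\gamma^V_{trunc}$ with junction point $V=v_0+\Phi(u_1)-\Phi(u_0)$.
   Context: Let $I\subset\mathbb{R}$ be an open interval and $f:I\to(0,\infty)$ a smooth function. A Riemannian surface is given in geodesic coordinates $(u,v)$ with metric $du^2+f(u)^2dv^2$, and points are identified with their coordinates $(u,v)$. Curves that are graphs $u=u(v)$, $v\in[v_0,v_1]$, have resistance $$\mathcal{R}[u]=\int_{v_0}^{v_1}\frac{f(u(v))^2}{u'(v)^2+f(u(v))^2}\,dv .$$ $\Phi:I\to\mathbb{R}$ denotes an antiderivative of $1/f$. $PC^1$ means continuous and piecewise $C^1$ (finitely many corners), and $$\mathcal{C}^m_{0,1}=\{u\in PC^1([v_0,v_1],\mathbb{R}^+): u'\ge 0,\ u(v_0)=u_0,\ u(v_1)=u_1\},$$ where $u'\ge0$ is understood wherever $u'$ exists. For $v_c\in(v_0,v_1)$, the truncated loxodrome $\gamma_{trunc}^{v_c}$ connecting $A$ and $B$ is the curve $u=u(v)$ given by $\Phi(u(v))=k(v-v_0)+\Phi(u_0)$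 for $v\in[v_0,v_c]$ and $\Phi(u(v))=\Phi(u_1)$ for $v\in[v_c,v_1]$, where $k=\frac{\Phi(u_1)-\Phi(u_0)}{v_c-v_0}$. *)

(* Defs.v *)
From Stdlib Require Import Reals.
From Coquelicot Require Import Coquelicot.
Open Scope R_scope.

Definition Rbar_open_interval (a b : Rbar) (x : R) : Prop :=
  Rbar_lt a x /\ Rbar_lt x b.

Definition smooth_on (I : R -> Prop) (f : R -> R) : Prop :=
  forall (n : nat) (x : R), I x -> ex_derive_n f n x.

Definition antiderivative_on (I : R -> Prop) (g Phi : R -> R) : Prop :=
  forall x : R, I x -> is_derive Phi x (g x).

(* Derivatives are taken within [a, b], hence one-sided at a and b, so that
   the values of u outside [a, b] play no role. *)
Definition C1_on_segment (a b : R) (u : R -> R) : Prop :=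
  exists u' : R -> R,
    continuous_on (fun x => a <= x <= b) u' /\
    forall x : R, a <= x <= b ->
      filterlim (fun y => (u y - u x) / (y - x))
        (within (fun y => a <= y <= b) (locally' x)) (locally (u' x)).

Definition PC1 (a b : R) (u : R -> R) : Prop :=
  continuous_on (fun x => a <= x <= b) u /\
  exists (n : nat) (t : nat -> R),
    t 0%nat = a /\ t n = b /\
    forall i : nat, (i < n)%nat ->
      t i < t (S i) /\ C1_on_segment (t i) (t (S i)) u.

(* Curves u = u(v) on [v0, v1] are total functions R -> R whose values outside
   [v0, v1] are irrelevant. *)
Definition monotone_class (u0 u1 v0 v1 : R) (u : R -> R) : Prop :=
  PC1 v0 v1 u /\
  (forall v : R, v0 <= v <= v1 -> 0 < u v) /\
  (forall v : R, v0 < v < v1 -> ex_derive u v -> 0 <= Derive u v) /\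
  u v0 = u0 /\ u v1 = u1.

(* [Derive u] is unspecified at the corners and at the endpoints; these finitely
   many points do not affect the integral. *)
Definition resistance (f : R -> R) (v0 v1 : R) (u : R -> R) : R :=
  RInt (fun v => (f (u v)) ^ 2 / ((Derive u v) ^ 2 + (f (u v)) ^ 2)) v0 v1.

(* Phi is only meaningful on I, so the implicit equations are required to be
   solved with values in I; Phi being strictly increasing on I, they then
   determine u on [v0, v1]. *)
Definition truncated_loxodrome (I : R -> Prop) (Phi : R -> R)
    (u0 u1 v0 v1 vc : R) (u : R -> R) : Prop :=
  let k := (Phi u1 - Phi u0) / (vc - v0) in
  v0 < vc < v1 /\
  (forall v : R, v0 <= v <= v1 -> I (u v)) /\
  (forall v : R, v0 <= v <= vc -> Phi (u v) = k * (v - v0) + Phi u0) /\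
  (forall v : R, vc <= v <= v1 -> Phi (u v) = Phi u1).

Definition minimum_value (C : (R -> R) -> Prop) (F : (R -> R) -> R) (m : R)
    : Prop :=
  (exists u, C u /\ F u = m) /\ (forall u, C u -> m <= F u).

(* Main.v *)
Require Import Defs.
From Stdlib Require Import Reals Lra Lia.
From Coquelicot Require Import Coquelicot.
Open Scope R_scope.

(** Write w = Phi o u for the height of a curve.  Since Phi' = 1/f, one has
    w' = u'/f(u), and the resistance density is 1/(1 + w'^2).  For w' >= 0 this
    is at least 1 - w'/2, with equality exactly at the slopes w' = 0 and w' = 1
    ([tangent_bound]): the line is tangent to the graph at slope 1 and meets it
    again at slope 0.  Integrating 1 - w'/2 gives
    (v1 - v0) - (Phi u1 - Phi u0)/2, a value that depends on the end points only;
    this is the lower bound.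

    A curve reaches the bound when its slope in height takes no value but 0 and 1,
    and rising with slope 1 until the height Phi u1 is attained, then staying
    there, is such a curve.  It fits in the angular amplitude because
    v1 - v0 > Phi u1 - Phi u0, and it is the truncated loxodrome with junction
    point V.

    The lower bound is proved on one C^1 piece in [resistance_lower_bound_C1] and
    summed over the pieces in [resistance_lower_bound_piecewise].  The monotonicity
    of u is what keeps u inside [u0, u1], where f is controlled.  The attainment
    rests on [antiderivative_mean_value]: differences of u are differences of
    height multiplied by a value of f.  This gives the continuity of u and its
    one-sided derivatives from the implicit equation for Phi o u, with no inverse
    function theorem. *)

(** * Derivatives within a segment *)

Lemma filterlim_quotient_within_iff (s t x l : R) (u : R -> R) :
  filterlim (fun y => (u y - u x) / (y - x))
    (within (fun y => s <= y <= t) (locally' x)) (locally l) <->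
  (forall eps : posreal, exists delta : posreal, forall y : R,
     s <= y <= t -> y <> x -> Rabs (y - x) < delta ->
     Rabs ((u y - u x) / (y - x) - l) < eps).
Proof.
  split.
  - intros H eps.
    destruct (H (fun z => Rabs (z - l) < eps)) as [d Hd].
    { exists eps; intros z Hz; exact Hz. }
    exists d; intros y Hy Hyx Hb; exact (Hd y Hb Hyx Hy).
  - intros H P [eps HP].
    destruct (H eps) as [d Hd].
    exists d; intros y Hb Hyx Hy.
    apply HP; apply Hd; assumption.
Qed.

Lemma is_derive_of_quotient_within (s t x l : R) (u : R -> R) :
  s < x < t ->
  filterlim (fun y => (u y - u x) / (y - x))
    (within (fun y => s <= y <= t) (locally' x)) (locally l) ->
  is_derive u x l.
Proof.
  intros Hx H.
  apply is_derive_Reals; intros eps Heps.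
  destruct (proj1 (filterlim_quotient_within_iff s t x l u) H (mkposreal eps Heps))
    as [d Hd]; simpl in Hd.
  assert (Hp : 0 < Rmin d (Rmin (x - s) (t - x))).
  { pose proof (cond_pos d). repeat apply Rmin_glb_lt; lra. }
  exists (mkposreal _ Hp); simpl; intros h Hh Hhd.
  pose proof (Rmin_l d (Rmin (x - s) (t - x))).
  pose proof (Rmin_r d (Rmin (x - s) (t - x))).
  pose proof (Rmin_l (x - s) (t - x)).
  pose proof (Rmin_r (x - s) (t - x)).
  assert (Hb := Rabs_def2 _ _ Hhd).
  specialize (Hd (x + h)).
  replace (x + h - x) with h in Hd by ring.
  apply Hd; lra.
Qed.

Lemma Derive_nonneg_of_nondecreasing (s t x : R) (u : R -> R) :
  s < x < t ->
  (forall y z : R, s <= y -> y <= z -> z <= t -> u y <= u z) ->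
  ex_derive u x -> 0 <= Derive u x.
Proof.
  intros Hx Hmon Hex.
  destruct (Rle_or_lt 0 (Derive u x)) as [H | Hneg]; [exact H | exfalso].
  apply Derive_correct in Hex; apply is_derive_Reals in Hex.
  destruct (Hex (- Derive u x)) as [d Hd]; [lra |].
  set (h := Rmin (d / 2) (t - x)).
  pose proof (cond_pos d).
  assert (Hh : 0 < h) by (apply Rmin_glb_lt; lra).
  assert (Hhd : h <= d / 2) by apply Rmin_l.
  assert (Hht : h <= t - x) by apply Rmin_r.
  specialize (Hd h).
  rewrite (Rabs_pos_eq h) in Hd by lra.
  specialize (Hd ltac:(lra) ltac:(lra)).
  apply Rabs_def2 in Hd.
  assert (0 <= (u (x + h) - u x) / h).
  { apply Rdiv_le_0_compat; [| lra].
    specialize (Hmon x (x + h) ltac:(lra) ltac:(lra) ltac:(lra)); lra. }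
  lra.
Qed.

(** Composing with this retraction onto [s, t] turns a function continuous on the
    segment into one continuous on the whole line, as the integration and mean
    value theorems require. *)
Definition clamp (s t x : R) : R := Rmax s (Rmin x t).

Lemma clamp_in (s t x : R) : s <= t -> s <= clamp s t x <= t.
Proof.
  intros; unfold clamp, Rmax, Rmin; repeat destruct Rle_dec; lra.
Qed.

Lemma clamp_id (s t x : R) : s <= x <= t -> clamp s t x = x.
Proof.
  intros; unfold clamp, Rmax, Rmin; repeat destruct Rle_dec; lra.
Qed.

Lemma continuous_clamp (s t : R) (h : R -> R) : s <= t ->
  continuous_on (fun x => s <= x <= t) h ->
  forall x : R, continuous (fun y => h (clamp s t y)) x.
Proof.
  intros Hst Hh x P HP.
  destruct (Hh (clamp s t x) (clamp_in s t x Hst) P HP) as [d Hd].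
  exists d; intros y Hy.
  apply Hd; [| apply clamp_in, Hst].
  change (Rabs (clamp s t y - clamp s t x) < d).
  change (Rabs (y - x) < d) in Hy.
  revert Hy; unfold clamp, Rmax, Rmin, Rabs.
  repeat destruct Rle_dec; repeat destruct Rcase_abs; lra.
Qed.

(** * The lower bound *)

(** The difference of the two sides is x (x - 1)^2 / (2 (1 + x^2)). *)
Lemma tangent_bound (x : R) : 0 <= x -> 1 - x / 2 <= / (1 + x ^ 2).
Proof.
  intros Hx.
  replace (1 - x / 2) with (/ (1 + x ^ 2) - x * (x - 1) ^ 2 / 2 * / (1 + x ^ 2))
    by (field; nra).
  assert (0 < / (1 + x ^ 2)) by (apply Rinv_0_lt_compat; nra).
  assert (0 <= x * (x - 1) ^ 2) by (apply Rmult_le_pos; [lra | apply pow2_ge_0]).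
  nra.
Qed.

Lemma nondecreasing_of_derive_nonneg (s t : R) (F : R -> R) :
  continuous_on (fun x => s <= x <= t) F ->
  (forall x : R, s < x < t -> ex_derive F x /\ 0 <= Derive F x) ->
  forall y z : R, s <= y -> y <= z -> z <= t -> F y <= F z.
Proof.
  intros Hc Hd y z Hy Hyz Hz.
  assert (Hst : s <= t) by lra.
  set (U := fun x => F (clamp s t x)).
  (* The intermediate point may be an end point, where [Derive F] is uncontrolled;
     the maximum with 0 makes the sign known there as well. *)
  destruct (MVT_gen U y z (fun x => Rmax 0 (Derive F x))) as [c [_ Hc2]].
  - rewrite Rmin_left, Rmax_right by lra; intros x Hx.
    destruct (Hd x ltac:(lra)) as [Hex Hpos].
    rewrite Rmax_right by exact Hpos.
    apply is_derive_ext_loc with F.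
    + apply (locally_interval _ x s t); simpl; try lra.
      intros w Hw1 Hw2; unfold U; simpl in Hw1, Hw2; rewrite clamp_id; auto; lra.
    + apply Derive_correct, Hex.
  - intros x _; apply continuity_pt_filterlim.
    exact (continuous_clamp s t F Hst Hc x).
  - revert Hc2; unfold U; rewrite !clamp_id by lra; intros Hc2.
    pose proof (Rmax_l 0 (Derive F c)).
    assert (0 <= Rmax 0 (Derive F c) * (z - y)) by (apply Rmult_le_pos; lra).
    lra.
Qed.

(** The function F v = int_s^v G - (v - s) + Phi(u v)/2 has derivative
    1/(1 + w'^2) - 1 + w'/2 >= 0 inside the segment and is continuous up to its
    ends, so F s <= F t.  The integrability is needed to add up the pieces. *)
Lemma resistance_lower_bound_C1 (D : R -> Prop) (f Phi : R -> R) (s t : R)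
  (u : R -> R) :
  (forall x : R, D x -> continuous f x) ->
  (forall x : R, D x -> 0 < f x) ->
  antiderivative_on D (fun x => / f x) Phi ->
  s <= t ->
  continuous_on (fun x => s <= x <= t) u ->
  C1_on_segment s t u ->
  (forall x : R, s <= x <= t -> D (u x)) ->
  (forall x : R, s < x < t -> ex_derive u x -> 0 <= Derive u x) ->
  ex_RInt (fun v => f (u v) ^ 2 / (Derive u v ^ 2 + f (u v) ^ 2)) s t /\
  (t - s) - 1 / 2 * (Phi (u t) - Phi (u s)) <= resistance f s t u.
Proof.
  intros f_cont f_pos Phi_derive Hst Hcont [u' [Hu'c Hu']] HD Hmon.
  set (U := fun x => u (clamp s t x)).
  set (g := fun x => u' (clamp s t x)).
  set (G := fun x => f (U x) ^ 2 / (g x ^ 2 + f (U x) ^ 2)).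
  assert (HUD : forall x, D (U x)) by (intros x; apply HD, clamp_in, Hst).
  assert (HUc : forall x, continuous U x) by (apply continuous_clamp; assumption).
  assert (Hgc : forall x, continuous g x) by (apply continuous_clamp; assumption).
  assert (Hfc : forall x, continuous (fun y => f (U y)) x).
  { intros x; apply continuous_comp; [apply HUc | apply f_cont, HUD]. }
  assert (HGc : forall x, continuous G x).
  { intros x.
    apply (continuous_mult (fun x => f (U x) ^ 2)
             (fun x => / (g x ^ 2 + f (U x) ^ 2))).
    - apply (continuous_comp (fun x => f (U x)) (fun z => z ^ 2)); [apply Hfc |].
      apply (ex_derive_continuous (fun z : R => z ^ 2)); auto_derive; trivial.
    - apply (continuous_comp (fun x => g x ^ 2 + f (U x) ^ 2) Rinv).
      + apply (continuous_plus (fun x => g x ^ 2) (fun x => f (U x) ^ 2)).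
        * apply (continuous_comp g (fun z => z ^ 2)); [apply Hgc |].
          apply (ex_derive_continuous (fun z : R => z ^ 2)); auto_derive; trivial.
        * apply (continuous_comp (fun x => f (U x)) (fun z => z ^ 2)); [apply Hfc |].
          apply (ex_derive_continuous (fun z : R => z ^ 2)); auto_derive; trivial.
      + apply (ex_derive_continuous Rinv); auto_derive.
        pose proof (f_pos _ (HUD x)); nra. }
  assert (Hder : forall x, s < x < t -> is_derive u x (g x)).
  { intros x Hx; unfold g; rewrite clamp_id by lra.
    apply is_derive_of_quotient_within with s t; [exact Hx |].
    apply Hu'; lra. }
  assert (HG : forall x, s < x < t ->
            G x = f (u x) ^ 2 / (Derive u x ^ 2 + f (u x) ^ 2)).
  { intros x Hx; unfold G, U.
    rewrite (is_derive_unique _ _ _ (Hder x Hx)), clamp_id by lra; reflexivity. }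
  assert (HexG : forall x y, ex_RInt G x y).
  { intros x y; apply (ex_RInt_continuous G); intros z _; apply HGc. }
  split.
  { apply ex_RInt_ext with G; [| apply HexG].
    rewrite Rmin_left, Rmax_right by exact Hst; exact HG. }
  unfold resistance; rewrite <- (RInt_ext G).
  2: { rewrite Rmin_left, Rmax_right by exact Hst; exact HG. }
  set (F := fun x => RInt G s x - (x - s) + 1 / 2 * Phi (U x)).
  assert (HIder : forall x, is_derive (RInt G s) x (G x)).
  { intros x; apply is_derive_RInt with s; [| apply HGc].
    apply filter_forall; intros y.
    exact (RInt_correct _ _ _ (HexG s y)). }
  (* F is monotone by the tangent bound at w' = g / f(U). *)
  assert (HFle : F s <= F t).
  { apply (nondecreasing_of_derive_nonneg s t F); try lra.
    - apply continuous_on_forall; intros x _.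
      apply (continuous_plus (fun x => RInt G s x - (x - s))
               (fun x => 1 / 2 * Phi (U x))).
      + apply (continuous_minus (RInt G s) (fun x => x - s)).
        * apply (ex_derive_continuous (RInt G s)); exists (G x); apply HIder.
        * apply (ex_derive_continuous (fun x => x - s)); auto_derive; trivial.
      + apply (continuous_scal_r (1 / 2) (fun x => Phi (U x))).
        apply continuous_comp; [apply HUc |].
        apply (ex_derive_continuous Phi); eexists; apply Phi_derive, HUD.
    - intros x Hx.
      assert (HUder : is_derive U x (g x)).
      { apply is_derive_ext_loc with u; [| apply Hder, Hx].
        apply (locally_interval _ x s t); simpl; try lra.
        intros w Hw1 Hw2; simpl in Hw1, Hw2; unfold U; rewrite clamp_id; auto; lra. }
      assert (HFder : is_derive F x (G x - 1 + 1 / 2 * (g x * / f (U x)))).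
      { apply (is_derive_plus (fun x => RInt G s x - (x - s))
                 (fun x => 1 / 2 * Phi (U x))).
        - apply (is_derive_minus (RInt G s) (fun x => x - s)); [apply HIder |].
          auto_derive; trivial; ring.
        - apply is_derive_scal.
          apply (is_derive_comp Phi U); [apply Phi_derive, HUD | exact HUder]. }
      split; [eexists; exact HFder |].
      rewrite (is_derive_unique _ _ _ HFder).
      assert (Hg : 0 <= g x).
      { rewrite <- (is_derive_unique _ _ _ (Hder x Hx)).
        apply Hmon; [exact Hx | eexists; apply Hder, Hx]. }
      pose proof (f_pos _ (HUD x)) as Hf.
      assert (Hw : 0 <= g x / f (U x)) by (apply Rdiv_le_0_compat; assumption).
      pose proof (tangent_bound _ Hw) as Htan.
      replace (G x) with (/ (1 + (g x / f (U x)) ^ 2))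
        by (unfold G; field; nra).
      unfold Rdiv in *; lra. }
  revert HFle; unfold F, U; rewrite !clamp_id by lra.
  rewrite RInt_point; unfold zero; simpl; lra.
Qed.


Lemma partition_le (n : nat) (t : nat -> R) :
  (forall i : nat, (i < n)%nat -> t i < t (S i)) -> t 0%nat <= t n.
Proof.
  induction n as [| n IH]; intros Ht; [lra |].
  pose proof (Ht n ltac:(lia)).
  assert (t 0%nat <= t n) by (apply IH; intros i Hi; apply Ht; lia).
  lra.
Qed.

Lemma C1_on_segment_ex_derive (s t x : R) (u : R -> R) :
  C1_on_segment s t u -> s < x < t -> ex_derive u x.
Proof.
  intros [u' [_ Hu']] Hx; exists (u' x).
  apply is_derive_of_quotient_within with s t; [exact Hx |].
  apply Hu'; lra.
Qed.

Lemma piecewise_C1_nondecreasing (n : nat) (t : nat -> R) (u : R -> R) :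
  (forall i : nat, (i < n)%nat -> t i < t (S i) /\ C1_on_segment (t i) (t (S i)) u) ->
  continuous_on (fun x => t 0%nat <= x <= t n) u ->
  (forall x : R, t 0%nat < x < t n -> ex_derive u x -> 0 <= Derive u x) ->
  forall y z : R, t 0%nat <= y -> y <= z -> z <= t n -> u y <= u z.
Proof.
  induction n as [| n IH]; intros Ht Hc Hd y z Hy Hyz Hz.
  { replace z with y by lra; lra. }
  assert (H0 : t 0%nat <= t n) by (apply partition_le; intros i Hi; apply Ht; lia).
  destruct (Ht n ltac:(lia)) as [Hn HC1].
  assert (Hleft : forall y z, t 0%nat <= y -> y <= z -> z <= t n -> u y <= u z).
  { apply IH.
    - intros i Hi; apply Ht; lia.
    - eapply continuous_on_subset; [| exact Hc]; simpl; intros; lra.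
    - intros x Hx; apply Hd; lra. }
  assert (Hright : forall y z, t n <= y -> y <= z -> z <= t (S n) -> u y <= u z).
  { apply nondecreasing_of_derive_nonneg.
    - eapply continuous_on_subset; [| exact Hc]; simpl; intros; lra.
    - intros x Hx.
      pose proof (C1_on_segment_ex_derive _ _ x u HC1 Hx) as Hex.
      split; [exact Hex | apply Hd; [lra | exact Hex]]. }
  destruct (Rle_or_lt z (t n)) as [Hzn | Hzn]; [apply Hleft; assumption |].
  destruct (Rle_or_lt y (t n)) as [Hyn | Hyn].
  - apply Rle_trans with (u (t n)); [apply Hleft | apply Hright]; lra.
  - apply Hright; lra.
Qed.

Lemma resistance_lower_bound_piecewise (D : R -> Prop) (f Phi : R -> R) (n : nat)
  (t : nat -> R) (u : R -> R) :
  (forall x : R, D x -> continuous f x) ->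
  (forall x : R, D x -> 0 < f x) ->
  antiderivative_on D (fun x => / f x) Phi ->
  (forall i : nat, (i < n)%nat -> t i < t (S i) /\ C1_on_segment (t i) (t (S i)) u) ->
  continuous_on (fun x => t 0%nat <= x <= t n) u ->
  (forall x : R, t 0%nat <= x <= t n -> D (u x)) ->
  (forall x : R, t 0%nat < x < t n -> ex_derive u x -> 0 <= Derive u x) ->
  ex_RInt (fun v => f (u v) ^ 2 / (Derive u v ^ 2 + f (u v) ^ 2)) (t 0%nat) (t n) /\
  (t n - t 0%nat) - 1 / 2 * (Phi (u (t n)) - Phi (u (t 0%nat)))
    <= resistance f (t 0%nat) (t n) u.
Proof.
  intros f_cont f_pos Phi_derive.
  induction n as [| n IH]; intros Ht Hc HD Hd.
  { split; [apply ex_RInt_point |].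
    unfold resistance; rewrite RInt_point; unfold zero; simpl; lra. }
  assert (H0 : t 0%nat <= t n) by (apply partition_le; intros i Hi; apply Ht; lia).
  destruct (Ht n ltac:(lia)) as [Hn HC1].
  destruct IH as [Hex1 Hle1].
  { intros i Hi; apply Ht; lia. }
  { eapply continuous_on_subset; [| exact Hc]; simpl; intros; lra. }
  { intros x Hx; apply HD; lra. }
  { intros x Hx; apply Hd; lra. }
  destruct (resistance_lower_bound_C1 D f Phi (t n) (t (S n)) u) as [Hex2 Hle2];
    try assumption; try lra.
  { eapply continuous_on_subset; [| exact Hc]; simpl; intros; lra. }
  { intros x Hx; apply HD; lra. }
  { intros x Hx; apply Hd; lra. }
  split; [eapply ex_RInt_Chasles; eassumption |].
  unfold resistance in *.
  rewrite <- (RInt_Chasles _ _ _ _ Hex1 Hex2); unfold plus; simpl; simpl in Hle1, Hle2; lra.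
Qed.

Lemma monotone_class_nondecreasing (u0 u1 v0 v1 : R) (u : R -> R) :
  monotone_class u0 u1 v0 v1 u ->
  forall y z : R, v0 <= y -> y <= z -> z <= v1 -> u y <= u z.
Proof.
  intros [[Hc [n [t [Ht0 [Htn Ht]]]]] [_ [Hd _]]]; subst v0 v1.
  exact (piecewise_C1_nondecreasing n t u Ht Hc Hd).
Qed.

(** The bound for a piece needs the hypotheses on f and Phi only on the values
    of u, and a nondecreasing u has its values between those at its end points. *)
Lemma resistance_lower_bound (f Phi : R -> R) (u0 u1 v0 v1 : R) (u : R -> R) :
  v0 <= v1 ->
  (forall x : R, u0 <= x <= u1 -> continuous f x) ->
  (forall x : R, u0 <= x <= u1 -> 0 < f x) ->
  antiderivative_on (fun x => u0 <= x <= u1) (fun x => / f x) Phi ->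
  monotone_class u0 u1 v0 v1 u ->
  (v1 - v0) - 1 / 2 * (Phi u1 - Phi u0) <= resistance f v0 v1 u.
Proof.
  intros Hv f_cont f_pos Phi_derive Hu.
  pose proof (monotone_class_nondecreasing _ _ _ _ _ Hu) as Hmon.
  destruct Hu as [[Hc [n [t [Ht0 [Htn Ht]]]]] [_ [Hd [Hu0 Hu1]]]].
  assert (HD : forall x, v0 <= x <= v1 -> u0 <= u x <= u1).
  { intros x Hx; rewrite <- Hu0, <- Hu1; split; apply Hmon; lra. }
  rewrite <- Hu0, <- Hu1; subst v0 v1.
  apply (resistance_lower_bound_piecewise (fun x => u0 <= x <= u1)); assumption.
Qed.

(** * Loxodromes *)

Lemma antiderivative_increasing (D : R -> Prop) (f Phi : R -> R) (x y : R) :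
  (forall z : R, D z -> 0 < f z) ->
  antiderivative_on D (fun z => / f z) Phi ->
  (forall z : R, x <= z <= y -> D z) ->
  x < y -> Phi x < Phi y.
Proof.
  intros f_pos Phi_derive HD Hxy.
  destruct (MVT_gen Phi x y (fun z => / f z)) as [c [Hc Heq]].
  - rewrite Rmin_left, Rmax_right by lra; intros z Hz; apply Phi_derive, HD; lra.
  - rewrite Rmin_left, Rmax_right by lra; intros z Hz.
    apply continuity_pt_filterlim, (ex_derive_continuous Phi).
    eexists; apply Phi_derive, HD; lra.
  - rewrite Rmin_left, Rmax_right in Hc by lra.
    pose proof (Rinv_0_lt_compat _ (f_pos c (HD c Hc))).
    assert (0 < / f c * (y - x)) by (apply Rmult_lt_0_compat; lra).
    lra.
Qed.

Lemma Rbar_open_interval_convex (a b : Rbar) (x y z : R) :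
  Rbar_open_interval a b x -> Rbar_open_interval a b y ->
  x <= z <= y -> Rbar_open_interval a b z.
Proof.
  unfold Rbar_open_interval; destruct a, b; simpl; intuition lra.
Qed.

(** The mean value theorem for Phi, solved for y - x.  It replaces the
    differentiability of the inverse function of Phi. *)
Lemma antiderivative_mean_value (p q : R) (f Phi : R -> R) (x y : R) :
  (forall z : R, p <= z <= q -> 0 < f z) ->
  antiderivative_on (fun z => p <= z <= q) (fun z => / f z) Phi ->
  p <= x <= q -> p <= y <= q ->
  exists c : R, p <= c <= q /\ Rabs (c - x) <= Rabs (y - x) /\
    y - x = f c * (Phi y - Phi x).
Proof.
  intros f_pos Phi_derive Hx Hy.
  assert (Hbetween : forall z, Rmin x y <= z <= Rmax x y ->
            p <= z <= q /\ Rabs (z - x) <= Rabs (y - x)).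
  { intros z; unfold Rmin, Rmax, Rabs.
    repeat destruct Rle_dec; repeat destruct Rcase_abs; lra. }
  destruct (MVT_gen Phi x y (fun z => / f z)) as [c [Hc Heq]].
  - intros z Hz; apply Phi_derive, Hbetween; lra.
  - intros z Hz; apply continuity_pt_filterlim, (ex_derive_continuous Phi).
    eexists; apply Phi_derive, Hbetween, Hz.
  - destruct (Hbetween c Hc) as [Hcpq Hcx].
    exists c; split; [exact Hcpq | split; [exact Hcx |]].
    rewrite Heq; field.
    pose proof (f_pos c Hcpq); lra.
Qed.

(** By the mean value identity u is Lipschitz with constant K max f. *)
Lemma continuous_on_of_Lipschitz_height (p q s t K : R) (f Phi u : R -> R) :
  (forall z : R, p <= z <= q -> continuous f z) ->
  (forall z : R, p <= z <= q -> 0 < f z) ->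
  antiderivative_on (fun z => p <= z <= q) (fun z => / f z) Phi ->
  (forall v : R, s <= v <= t -> p <= u v <= q) ->
  (forall v w : R, s <= v <= t -> s <= w <= t ->
     Rabs (Phi (u w) - Phi (u v)) <= K * Rabs (w - v)) ->
  continuous_on (fun v => s <= v <= t) u.
Proof.
  intros f_cont f_pos Phi_derive Hu HLip x Hx P [eps HP].
  destruct (continuity_ab_maj f p q) as [M [HM HMpq]].
  { pose proof (Hu x Hx); lra. }
  { intros c Hc; apply continuity_pt_filterlim; exact (f_cont c Hc). }
  pose proof (f_pos M HMpq) as HM0.
  (* The summand 1 makes L positive, so that eps / L makes sense when K = 0. *)
  set (L := f M * Rabs K + 1).
  assert (HL : 0 < L).
  { pose proof (Rabs_pos K); unfold L.
    assert (0 <= f M * Rabs K) by (apply Rmult_le_pos; lra); lra. }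
  exists (mkposreal (eps / L) (Rdiv_lt_0_compat _ _ (cond_pos eps) HL)).
  intros y Hy Hyst; apply HP.
  change (Rabs (u y - u x) < eps).
  change (Rabs (y - x) < eps / L) in Hy.
  destruct (antiderivative_mean_value p q f Phi (u x) (u y)) as [c [Hc [_ Heq]]];
    auto.
  rewrite Heq, Rabs_mult, (Rabs_pos_eq (f c)) by (apply Rlt_le, f_pos, Hc).
  apply Rle_lt_trans with (L * Rabs (y - x)).
  - pose proof (HLip x y Hx Hyst).
    pose proof (HM c Hc); pose proof (f_pos c Hc).
    pose proof (Rabs_pos (y - x)).
    assert (K * Rabs (y - x) <= Rabs K * Rabs (y - x))
      by (apply Rmult_le_compat_r; [assumption | apply Rle_abs]).
    apply Rle_trans with (f M * (Rabs K * Rabs (y - x))).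
    + apply Rmult_le_compat; try lra; apply Rabs_pos.
    + unfold L; lra.
  - apply Rmult_lt_reg_l with (/ L); [apply Rinv_0_lt_compat, HL |].
    replace (/ L * (L * Rabs (y - x))) with (Rabs (y - x)) by (field; lra).
    replace (/ L * eps) with (eps / L) by (unfold Rdiv; ring).
    exact Hy.
Qed.

(** Between x and y the difference quotient of u is exactly k f(z), for some z
    between u x and u y; the continuity of u and f then gives the limit. *)
Lemma loxodrome_quotient (p q s t k c : R) (f Phi u : R -> R) :
  (forall z : R, p <= z <= q -> continuous f z) ->
  (forall z : R, p <= z <= q -> 0 < f z) ->
  antiderivative_on (fun z => p <= z <= q) (fun z => / f z) Phi ->
  (forall v : R, s <= v <= t -> p <= u v <= q) ->
  (forall v : R, s <= v <= t -> Phi (u v) = k * (v - s) + c) ->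
  continuous_on (fun v => s <= v <= t) u /\
  forall x : R, s <= x <= t ->
    filterlim (fun y => (u y - u x) / (y - x))
      (within (fun y => s <= y <= t) (locally' x)) (locally (k * f (u x))).
Proof.
  intros f_cont f_pos Phi_derive Hu Hlox.
  assert (Hc : continuous_on (fun v => s <= v <= t) u).
  { apply (continuous_on_of_Lipschitz_height p q s t (Rabs k) f Phi); auto.
    intros v w Hv Hw; rewrite (Hlox v Hv), (Hlox w Hw), <- Rabs_mult.
    apply Req_le; f_equal; ring. }
  split; [exact Hc |].
  intros x Hx; apply filterlim_quotient_within_iff; intros eps.
  assert (HK : 0 < Rabs k + 1) by (pose proof (Rabs_pos k); lra).
  assert (He : 0 < eps / (Rabs k + 1)) by (apply Rdiv_lt_0_compat; [apply cond_pos | lra]).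
  destruct (proj1 (filterlim_locally _ _) (f_cont (u x) (Hu x Hx)) (mkposreal _ He))
    as [d1 Hd1].
  destruct (proj1 (filterlim_locally _ _) (Hc x Hx) d1) as [d2 Hd2].
  exists d2; intros y Hy Hyx Hyd.
  destruct (antiderivative_mean_value p q f Phi (u x) (u y)) as [z [Hz [Hzx Heq]]];
    auto.
  assert (Huy : Rabs (u y - u x) < d1) by exact (Hd2 y Hyd Hy).
  assert (Hfz : Rabs (f z - f (u x)) < eps / (Rabs k + 1)).
  { apply (Hd1 z); change (Rabs (z - u x) < d1); lra. }
  rewrite Heq, (Hlox x Hx), (Hlox y Hy).
  replace (f z * (k * (y - s) + c - (k * (x - s) + c)) / (y - x) - k * f (u x))
    with (k * (f z - f (u x))) by (field; lra).
  rewrite Rabs_mult.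
  apply Rle_lt_trans with ((Rabs k) * (eps / (Rabs k + 1))).
  - apply Rmult_le_compat_l; [apply Rabs_pos | lra].
  - replace (pos eps) with ((Rabs k + 1) * (eps / (Rabs k + 1))) at 2 by (field; lra).
    lra.
Qed.

(** On an arc of slope k the resistance density is the constant 1/(1 + k^2). The
    inclined arc and the circular arc, which has k = 0, are both of this kind. *)
Lemma loxodrome_arc (p q s t k c : R) (f Phi u : R -> R) :
  (forall z : R, p <= z <= q -> continuous f z) ->
  (forall z : R, p <= z <= q -> 0 < f z) ->
  antiderivative_on (fun z => p <= z <= q) (fun z => / f z) Phi ->
  s <= t ->
  (forall v : R, s <= v <= t -> p <= u v <= q) ->
  (forall v : R, s <= v <= t -> Phi (u v) = k * (v - s) + c) ->
  C1_on_segment s t u /\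
  is_RInt (fun v => f (u v) ^ 2 / (Derive u v ^ 2 + f (u v) ^ 2)) s t
    ((t - s) / (1 + k ^ 2)).
Proof.
  intros f_cont f_pos Phi_derive Hst Hu Hlox.
  destruct (loxodrome_quotient p q s t k c f Phi u) as [Hc Hq]; auto.
  split.
  - exists (fun v => k * f (u v)); split; [| exact Hq].
    intros x Hx.
    apply (filterlim_comp _ _ _ u (fun z => k * f z) _ (locally (u x))).
    + exact (Hc x Hx).
    + apply (continuous_scal_r k f); exact (f_cont (u x) (Hu x Hx)).
  - apply is_RInt_ext with (fun _ => / (1 + k ^ 2)).
    + rewrite Rmin_left, Rmax_right by exact Hst; intros x Hx.
      rewrite (is_derive_unique u x (k * f (u x))).
      * pose proof (f_pos (u x) (Hu x ltac:(lra))).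
        change (/ (1 + k ^ 2) = f (u x) ^ 2 / ((k * f (u x)) ^ 2 + f (u x) ^ 2)).
        field; nra.
      * apply is_derive_of_quotient_within with s t; [exact Hx |].
        apply Hq; lra.
    + exact (is_RInt_const s t (/ (1 + k ^ 2))).
Qed.

(** The convexity of I and the injectivity of Phi on I make the implicit
    equations determine u; in particular u has the required end values. *)
Lemma truncated_loxodrome_resistance (I : R -> Prop) (f Phi : R -> R)
  (u0 u1 v0 v1 vc : R) (u : R -> R) :
  let k := (Phi u1 - Phi u0) / (vc - v0) in
  (forall x y z : R, I x -> I y -> x <= z <= y -> I z) ->
  (forall x : R, I x -> continuous f x) ->
  (forall x : R, I x -> 0 < f x) ->
  antiderivative_on I (fun x => / f x) Phi ->
  I u0 -> I u1 -> 0 < u0 -> u0 < u1 ->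
  truncated_loxodrome I Phi u0 u1 v0 v1 vc u ->
  monotone_class u0 u1 v0 v1 u /\
  resistance f v0 v1 u = (vc - v0) / (1 + k ^ 2) + (v1 - vc).
Proof.
  intros k Hconv f_cont f_pos Phi_derive HI0 HI1 Hu0 Hu01 [Hvc [HI [Hrise Hflat]]].
  fold k in Hrise.
  assert (Hinc : forall x y, I x -> I y -> x < y -> Phi x < Phi y).
  { intros x y Hx Hy; apply (antiderivative_increasing I f); auto.
    intros z Hz; exact (Hconv x y z Hx Hy Hz). }
  assert (Hinv : forall x y, I x -> I y -> Phi x <= Phi y -> x <= y).
  { intros x y Hx Hy Hxy; destruct (Rle_or_lt x y) as [H | H]; [exact H |].
    pose proof (Hinc y x Hy Hx H); lra. }
  pose proof (Hinc u0 u1 HI0 HI1 Hu01) as HPhi.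
  assert (Hk : 0 < k) by (apply Rdiv_lt_0_compat; lra).
  assert (Hkvc : k * (vc - v0) + Phi u0 = Phi u1) by (unfold k; field; lra).
  assert (Hmono : forall v w, v0 <= v -> v <= w -> w <= v1 -> u v <= u w).
  { intros v w Hv Hvw Hw; apply Hinv; [apply HI; lra | apply HI; lra |].
    destruct (Rle_or_lt w vc) as [Hwc | Hwc];
      [| destruct (Rle_or_lt v vc) as [Hvvc | Hvvc]].
    - rewrite !Hrise by lra.
      assert (k * (v - v0) <= k * (w - v0)) by (apply Rmult_le_compat_l; lra); lra.
    - rewrite (Hrise v), (Hflat w) by lra; rewrite <- Hkvc.
      assert (k * (v - v0) <= k * (vc - v0)) by (apply Rmult_le_compat_l; lra); lra.
    - rewrite !Hflat by lra; lra. }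
  assert (Huv0 : u v0 = u0).
  { assert (Phi (u v0) = Phi u0) by (rewrite Hrise by lra; ring).
    apply Rle_antisym; apply Hinv; auto; try (apply HI; lra); lra. }
  assert (Huv1 : u v1 = u1).
  { assert (Phi (u v1) = Phi u1) by (apply Hflat; lra).
    apply Rle_antisym; apply Hinv; auto; try (apply HI; lra); lra. }
  assert (Hrange : forall v, v0 <= v <= v1 -> u0 <= u v <= u1).
  { intros v Hv; rewrite <- Huv0 at 1; rewrite <- Huv1; split; apply Hmono; lra. }
  assert (HIseg : forall z, u0 <= z <= u1 -> I z) by (intros z; apply Hconv; assumption).
  assert (f_cont' : forall z, u0 <= z <= u1 -> continuous f z) by auto.
  assert (f_pos' : forall z, u0 <= z <= u1 -> 0 < f z) by auto.
  assert (Phi_derive' : antiderivative_on (fun z => u0 <= z <= u1) (fun z => / f z) Phi)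
    by (intros z Hz; apply Phi_derive, HIseg, Hz).
  destruct (loxodrome_arc u0 u1 v0 vc k (Phi u0) f Phi u) as [HC1 HI1'];
    auto; try lra.
  { intros v Hv; apply Hrange; lra. }
  destruct (loxodrome_arc u0 u1 vc v1 0 (Phi u1) f Phi u) as [HC2 HI2'];
    auto; try lra.
  { intros v Hv; apply Hrange; lra. }
  { intros v Hv; rewrite Hflat by lra; ring. }
  assert (Hc : continuous_on (fun v => v0 <= v <= v1) u).
  { apply (continuous_on_of_Lipschitz_height u0 u1 v0 v1 k f Phi); auto.
    assert (Hle : forall v w, v0 <= v -> v <= w -> w <= v1 ->
              0 <= Phi (u w) - Phi (u v) <= k * (w - v)).
    { intros v w Hv Hvw Hw.
      assert (0 <= k * (w - v)) by (apply Rmult_le_pos; lra).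
      destruct (Rle_or_lt w vc) as [Hwc | Hwc];
        [| destruct (Rle_or_lt v vc) as [Hvvc | Hvvc]].
      - rewrite !Hrise by lra; lra.
      - rewrite (Hrise v), (Hflat w) by lra; rewrite <- Hkvc.
        assert (0 <= k * (vc - v)) by (apply Rmult_le_pos; lra).
        assert (0 <= k * (w - vc)) by (apply Rmult_le_pos; lra).
        lra.
      - rewrite !Hflat by lra; lra. }
    intros v w Hv Hw; destruct (Rle_or_lt v w) as [Hvw | Hvw].
    - pose proof (Hle v w ltac:(lra) Hvw ltac:(lra)).
      rewrite !Rabs_pos_eq; lra.
    - pose proof (Hle w v ltac:(lra) ltac:(lra) ltac:(lra)).
      rewrite (Rabs_minus_sym (Phi (u w))), (Rabs_minus_sym w), !Rabs_pos_eq; lra. }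
  split.
  - split; [split; [exact Hc |] |].
    + exists 2%nat.
      exists (fun i => match i with 0%nat => v0 | 1%nat => vc | _ => v1 end).
      split; [reflexivity | split; [reflexivity |]].
      intros [| [| i]] Hi; [| | lia]; split; auto; lra.
    + split; [intros v Hv; pose proof (Hrange v Hv); lra |].
      split; [| split; assumption].
      intros v Hv; apply Derive_nonneg_of_nondecreasing with v0 v1; assumption.
  - apply is_RInt_unique.
    pose proof (is_RInt_Chasles _ _ _ _ _ _ HI1' HI2') as Hall.
    unfold plus in Hall; simpl in Hall.
    replace ((v1 - vc) / (1 + 0 * (0 * 1))) with (v1 - vc) in Hall by field.
    exact Hall.
Qed.

(** The intermediate value theorem solves the implicit equation at each v, the
    height stopping at Phi u1 once v passes vc. *)
Lemma truncated_loxodrome_exists (I : R -> Prop) (Phi : R -> R) (u0 u1 v0 v1 vc : R) :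
  (forall x : R, u0 <= x <= u1 -> I x) ->
  (forall x : R, u0 <= x <= u1 -> continuous Phi x) ->
  u0 <= u1 -> Phi u0 <= Phi u1 -> v0 < vc < v1 ->
  exists u : R -> R, truncated_loxodrome I Phi u0 u1 v0 v1 vc u.
Proof.
  intros HI Phi_cont Hu01 HPhi Hvc.
  set (k := (Phi u1 - Phi u0) / (vc - v0)).
  assert (Hk : 0 <= k) by (apply Rdiv_le_0_compat; lra).
  assert (Hkvc : k * (vc - v0) + Phi u0 = Phi u1) by (unfold k; field; lra).
  set (h := fun v => k * (clamp v0 vc v - v0) + Phi u0).
  assert (Hh : forall v, { x | u0 <= x <= u1 /\ Phi x = h v }).
  { intros v.
    destruct (IVT_gen (fun x => Phi (clamp u0 u1 x)) u0 u1 (h v)) as [x [Hx Heq]].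
    - intros x; apply continuity_pt_filterlim.
      apply (continuous_clamp u0 u1 Phi Hu01).
      apply continuous_on_forall; exact Phi_cont.
    - rewrite !clamp_id, Rmin_left, Rmax_right by lra.
      pose proof (clamp_in v0 vc v ltac:(lra)) as Hcl.
      assert (0 <= k * (clamp v0 vc v - v0)) by (apply Rmult_le_pos; lra).
      assert (0 <= k * (vc - clamp v0 vc v)) by (apply Rmult_le_pos; lra).
      unfold h; lra.
    - rewrite Rmin_left, Rmax_right in Hx by lra.
      rewrite clamp_id in Heq by lra.
      exists x; split; assumption. }
  exists (fun v => proj1_sig (Hh v)).
  split; [exact Hvc | split; [| split]]; intros v Hv;
    destruct (Hh v) as [x [Hx Heq]]; simpl.
  - apply HI, Hx.
  - rewrite Heq; unfold h; rewrite clamp_id by lra; reflexivity.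
  - rewrite Heq; unfold h; rewrite <- Hkvc.
    replace (clamp v0 vc v) with vc; [reflexivity |].
    unfold clamp; rewrite Rmin_right, Rmax_right by lra; reflexivity.
Qed.

(** * The minimum of the resistance *)

Theorem theorem6p2 (a b : Rbar) (f Phi : R -> R) (u0 u1 v0 v1 : R)
  (hf_smooth : smooth_on (Rbar_open_interval a b) f)
  (hf_pos : forall x : R, Rbar_open_interval a b x -> 0 < f x)
  (hPhi : antiderivative_on (Rbar_open_interval a b) (fun x => / f x) Phi)
  (hu0 : 0 < u0) (hu01 : u0 < u1)
  (hI : forall x : R, u0 <= x <= u1 -> Rbar_open_interval a b x)
  (hv : v0 < v1)
  (hamp : v1 - v0 > Phi u1 - Phi u0) :
  let m := (v1 - v0) - 1 / 2 * (Phi u1 - Phi u0) in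
  let V := v0 + (Phi u1 - Phi u0) in
  minimum_value (monotone_class u0 u1 v0 v1) (resistance f v0 v1) m /\
  (exists u : R -> R,
     truncated_loxodrome (Rbar_open_interval a b) Phi u0 u1 v0 v1 V u) /\
  (forall u : R -> R,
     truncated_loxodrome (Rbar_open_interval a b) Phi u0 u1 v0 v1 V u ->
     monotone_class u0 u1 v0 v1 u /\ resistance f v0 v1 u = m).
Proof.
  intros m V.
  set (I := Rbar_open_interval a b) in *.
  assert (f_cont : forall x, I x -> continuous f x).
  { intros x Hx; apply (ex_derive_continuous f); exact (hf_smooth 1%nat x Hx). }
  assert (HI0 : I u0) by (apply hI; lra).
  assert (HI1 : I u1) by (apply hI; lra).
  assert (HPhi : Phi u0 < Phi u1)
    by (apply (antiderivative_increasing I f); assumption).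
  assert (Hlox : forall u, truncated_loxodrome I Phi u0 u1 v0 v1 V u ->
            monotone_class u0 u1 v0 v1 u /\ resistance f v0 v1 u = m).
  { intros u Hu.
    destruct (truncated_loxodrome_resistance I f Phi u0 u1 v0 v1 V u) as [HC HR];
      try assumption.
    { exact (Rbar_open_interval_convex a b). }
    split; [exact HC |].
    (* This junction point gives the inclined arc slope 1. *)
    replace ((Phi u1 - Phi u0) / (V - v0)) with 1 in HR by (unfold V; field; lra).
    rewrite HR; unfold m, V; field. }
  assert (Hex : exists u, truncated_loxodrome I Phi u0 u1 v0 v1 V u).
  { apply truncated_loxodrome_exists; try assumption; unfold V; try lra.
    intros x Hx; apply (ex_derive_continuous Phi); eexists; apply hPhi, hI, Hx. }
  split; [split | split; assumption].
  - destruct Hex as [u Hu]; exists u; apply Hlox, Hu.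
  - intros u Hu; apply (resistance_lower_bound f Phi u0 u1); auto; try lra.
    intros x Hx; apply hPhi, hI, Hx.
Qed.
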